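(* Let $A\in\mathbb{R}_{\max}^{n\times n}$ be a matrix whose tropical algebraic eigenvalues, counted with multiplicity, are $\lambda_1\le\cdots\le\lambda_n$, and let $k\in[n]$. For each $i$ let $x_i\in\mathbb{R}_{\max}^n$ be a scaled generalized tropical eigenvector of $A$ corresponding to $\lambda_i$, and let $S=\mathrm{span}\{x_k,\ldots,x_n\}$. Then $$\min_{\substack{u\in S\\ u\neq(\varepsilon,\ldots,\varepsilon)^T}}\left((u^T\otimes A\otimes u)\otimes(u^T\otimes u)^{\otimes -1}\right)=\lambda_k .$$
   Context: $\mathbb{R}_{\max}=\mathbb{R}\cup\{-\infty\}$ is the tropical (max-plus) semiring with $a\oplus b=\max\{a,b\}$, $a\otimes b=a+b$, and additive neutral element $\varepsilon=-\infty$ (absorbing for $\otimes$); for $a\neq\varepsilon$, $a^{\otimes -1}=-a$. Write $[n]=\{1,\dots,n\}$. Matrix and vector operations are defined as in classical linear algebra with $(\oplus,\otimes)$ in place of $(+,\times)$; in particular $x^T\otimes A\otimes x=\max_{i,j\in[n]}(x_i+a_{ij}+x_j)$ and $x^T\otimes x=2\max_i x_i$ for a vector $x$ with entries $x_i$. Tropical algebraic eigenvalues: the tropical characteristic polynomial of $A=(a_{ij})\in\mathbb{R}_{\max}^{n\times n}$ is the formal polynomial $P_A(X)=\mathrm{per}(A\oplus X\otimes I)=\bigoplus_{k=0}^n c_{n-k}\otimes X^{\otimes k}$, where $I$ is the tropical identity matrix ($0$ on the diagonal, $\varepsilon$ elsewhere), $c_0=0$, and for $1\le m\le n$, $c_m=\max_{J\subseteq[n],|J|=m}\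 \max_{\sigma\in \mathrm{Sym}(J)}\sum_{i\in J}a_{i\sigma(i)}$. The tropical roots of a formal polynomial $P$ are: the points of $\mathbb{R}$ at which the maximum in the associated polynomial function $X\mapsto\max_k(c_{n-k}+kX)$ is attained by at least two distinct monomials (equivalently, its points of non-differentiability on $\mathbb{R}$), with multiplicity the change of slope there, and additionally $\varepsilon$ if $P$ has no constant term, with multiplicity the least exponent whose coefficient is not $\varepsilon$. The tropical algebraic eigenvalues of $A$ are the $n$ tropical roots of $P_A$ counted with multiplicity. A generalized tropical eigenvector of $A$ associated with a tropical algebraic eigenvalue $\lambda$ is a vector $x\in\mathbb{R}_{\max}^n$, $x\neq(\varepsilon,\ldots,\varepsilon)^T$, with $x^T\otimes A\otimes x=\lambda\otimes x^T\otimes x$. A vector $v\neq(\varepsilon,\ldots,\varepsilon)^T$ is scaled if $\Vert v\Vert:=\max\{v_1,\ldots,v_n\}=0$. For a set $T\subseteq\mathbb{R}_{\max}^n$, $\mathrm{span}(T)$ is the set of all max-combinations $\bigoplus_{x\in T}\alpha_x\otimes x$ with $\alpha_x\in\mathbb{R}_{\max}$, only finitely many $\alpha_x$ being finite (i.e. $\neq\varepsilon$). *)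

(* Defs.v *)
From HB Require Import structures.
From mathcomp Require Import all_boot all_order all_algebra all_fingroup.
From mathcomp Require Import all_classical all_reals.
Set Implicit Arguments.
Unset Strict Implicit.
Unset Printing Implicit Defensive.
Import Order.TTheory GRing.Theory Num.Theory.
Local Open Scope classical_set_scope.
Local Open Scope ring_scope.

(* The max-plus semiring: extended reals other than +oo, with the order
   inherited from \bar R.  It is made a commutative semiring so that the
   library's matrices and polynomials apply to it.  Pitfall: for elements of
   Rmax R, ring_scope is tropical: x + y is max, x * y is the sum of the
   extended reals, 0 is -oo (epsilon) and 1 is the real number 0. *)
Record Rmax (R : realDomainType) :=
  MkRmax { rmaxval :> \bar R; _ : rmaxval != +oo%E }.

HB.instance Definition _ (R : realDomainType) := [isSub for @rmaxval R].
HB.instance Definition _ (R : realDomainType) := [Choice of Rmax R by <:].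
Fact Rmax_display : Order.disp_t. Proof. exact: Order.Disp tt tt. Qed.
HB.instance Definition _ (R : realDomainType) :=
  [SubChoice_isSubOrder of Rmax R by <: with Rmax_display].

Section Semiring.
Variable R : realDomainType.
Implicit Types a b c : Rmax R.

Definition teps : Rmax R := @MkRmax R -oo%E isT.
Definition tfin (r : R) : Rmax R := @MkRmax R r%:E isT.

Fact tadd_subproof a b : Order.max (a : \bar R) (b : \bar R) != +oo%E.
Proof. by rewrite maxEle; case: ifP => _; [exact: (valP b) | exact: (valP a)]. Qed.
Definition tadd a b : Rmax R := MkRmax (tadd_subproof a b).

Fact tmul_subproof a b : ((a : \bar R) + (b : \bar R))%E != +oo%E.
Proof. by case: a b => [[r||] ?] [[s||] ?]. Qed.
Definition tmul a b : Rmax R := MkRmax (tmul_subproof a b).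

Fact taddA : associative tadd.
Proof. by move=> a b c; apply: val_inj; rewrite /= maxA. Qed.
Fact taddC : commutative tadd.
Proof. by move=> a b; apply: val_inj; rewrite /= maxC. Qed.
Fact tadd0 : left_id teps tadd.
Proof. by move=> a; apply: val_inj; rewrite /= maxC maxeNy. Qed.
HB.instance Definition _ := GRing.isNmodule.Build (Rmax R) taddA taddC tadd0.

Fact tmulA : associative tmul.
Proof. by move=> a b c; apply: val_inj; rewrite /= addeA. Qed.
Fact tmulC : commutative tmul.
Proof. by move=> a b; apply: val_inj; rewrite /= addeC. Qed.
Fact tmul1 : left_id (tfin 0) tmul.
Proof. by move=> a; apply: val_inj; rewrite /= add0e. Qed.
Fact tmulDl : left_distributive tmul (+%R : Rmax R -> Rmax R -> Rmax R).
Proof. by move=> a b c; apply: val_inj; rewrite /= adde_maxl. Qed.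
Fact tmul0 : left_zero (0 : Rmax R) tmul.
Proof. by move=> a; apply: val_inj. Qed.
Fact tone_neq0 : tfin 0 != (0 : Rmax R).
Proof. by []. Qed.
HB.instance Definition _ := GRing.Nmodule_isComNzSemiRing.Build (Rmax R)
  tmulA tmulC tmul1 tmulDl tmul0 tone_neq0.

Lemma tzeroE : (0 : Rmax R) = teps. Proof. reflexivity. Qed.
Lemma toneE : (1 : Rmax R) = tfin 0. Proof. reflexivity. Qed.
Lemma taddE a b : a + b = Order.max a b.
Proof.
apply: val_inj; rewrite (_ : val (a + b) = Order.max (val a) (val b)) //.
by rewrite maxElt [Order.max a b]maxElt -lt_val; case: ifP.
Qed.
Lemma tmulE (r s : R) : tfin r * tfin s = tfin (r + s).
Proof. exact: val_inj. Qed.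

Fact tinv_subproof a : (if a == teps then -oo else - (a : \bar R))%E != +oo%E.
Proof. by case: a => [[r||] ?]. Qed.
(* Tropical inverse; the value teps at teps is a dummy. *)
Definition tinv a : Rmax R := MkRmax (tinv_subproof a).

Lemma tinvE (r : R) : tinv (tfin r) = tfin (- r).
Proof. exact: val_inj. Qed.

End Semiring.

Section Tropical.
Variable R : realType.
Local Notation T := (Rmax R).

Definition permanent (S : comNzSemiRingType) n (A : 'M[S]_n) : S :=
  \sum_(s : 'S_n) \prod_(i < n) A i (s i).

Definition tchar_poly n (A : 'M[T]_n) : {poly T} :=
  permanent (map_mx polyC A + 'X%:M).

(* At a finite point the maximum is attained by two distinct monomials of P,
   a monomial being present in P when its coefficient is not epsilon. *)
Definition trop_root (P : {poly T}) (x : T) : Prop :=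
  if x == 0 then P`_0 = 0 else
  exists i j : nat,
    [/\ i != j, P`_i != 0, P`_j != 0,
        P`_i * x ^+ i = P.[x] & P`_j * x ^+ j = P.[x]].

(* s and t are the slopes of the polynomial function immediately to the left
   and to the right of r. *)
Definition slope_change (P : {poly T}) (r : R) (m : nat) : Prop :=
  exists s t : R,
    (exists2 e : R, 0 < e & forall h : R, 0 <= h <= e ->
       P.[tfin (r - h)] = P.[tfin r] * tfin (- (s * h)) /\
       P.[tfin (r + h)] = P.[tfin r] * tfin (t * h))
    /\ t - s = m%:R.

Definition trop_mult (P : {poly T}) (x : T) (m : nat) : Prop :=
  if (x : \bar R) is r%:E%E then slope_change P r m
  else P`_m != 0 /\ forall j : nat, (j < m)%N -> P`_j = 0.

Definition trop_roots n (P : {poly T}) (lam : 'I_n -> T) : Prop :=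
  (forall i, trop_root P (lam i)) /\
  (forall x, trop_root P x -> trop_mult P x #|[set i | lam i == x]%SET|).

Definition trop_eigenvalues n (A : 'M[T]_n) (lam : 'I_n -> T) : Prop :=
  trop_roots (tchar_poly A) lam.

Definition gen_eigenvector n (A : 'M[T]_n) (lam : T) (x : 'cV[T]_n) : Prop :=
  x != 0 /\ x^T *m A *m x = lam *: (x^T *m x).

Definition tnorm n (v : 'cV[T]_n) : T := \sum_(i < n) v i ord0.

Definition scaled n (v : 'cV[T]_n) : Prop := v != 0 /\ tnorm v = tfin 0.

(* The sequence s carries the finitely many coefficients alpha y that may
   differ from epsilon. *)
Definition tspan n (V : set 'cV[T]_n) : set 'cV[T]_n :=
  [set u | exists (s : seq 'cV[T]_n) (alpha : 'cV[T]_n -> T),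
     [/\ uniq s, (forall y, y \in s -> V y)
       & u = \sum_(y <- s) alpha y *: y]].

Definition rayleigh n (A : 'M[T]_n) (u : 'cV[T]_n) : T :=
  (u^T *m A *m u) ord0 ord0 * tinv ((u^T *m u) ord0 ord0).

Definition is_minimum (V : set T) (m : T) : Prop := V m /\ lbound V m.

End Tropical.

(* Main.v *)
Require Import Defs.
From mathcomp Require Import all_boot all_order all_algebra.
From mathcomp Require Import all_classical all_reals.
Import Order.TTheory GRing.Theory Num.Theory.
Local Open Scope classical_set_scope.
Local Open Scope ring_scope.

(** The tropical norm is linear and satisfies u^T u = ||u||^2.  If u is a
    combination of scaled vectors y with coefficients alpha_y, its norm is
    therefore the largest coefficient, say alpha_y.  Since u dominates
    alpha_y y entrywise, u^T A u >= alpha_y^2 (y^T A y) = alpha_y^2 lambda_y,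
    so the Rayleigh quotient of u is at least lambda_y >= lambda_k; x_k itself
    attains this bound. *)

Section MaxPlus.
Context {R : realDomainType}.
Implicit Types a b c : Rmax R.

(** Addition is the maximum, so inequalities become equations; monotonicity of products then follows
    from distributivity. *)
Lemma trop_leEadd a b : (a <= b)%O = (a + b == b).
Proof. by rewrite taddE eq_maxr. Qed.

Lemma trop_add_sel a b : a + b = a \/ a + b = b.
Proof. by rewrite taddE maxEle; case: ifP; [right | left]. Qed.

Lemma trop_addii a : a + a = a.
Proof. by rewrite taddE maxxx. Qed.

Lemma trop_le_addr a b : (a <= a + b)%O.
Proof. by rewrite trop_leEadd addrA trop_addii. Qed.

Lemma trop_ler_wM2r c a b : (a <= b)%O -> (a * c <= b * c)%O.
Proof. by rewrite !trop_leEadd -mulrDl => /eqP ->. Qed.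

(** The order is total: if [a <= b], then [a ^+ 2 <= a * b <= b ^+ 2], so both sides are
    [b ^+ 2]. *)
Lemma trop_sqrD a b : (a + b) ^+ 2 = a ^+ 2 + b ^+ 2.
Proof.
wlog ab : a b / a + b = b => [hwlog|].
  have [ab|] := trop_add_sel a b; last exact: hwlog.
  by rewrite addrC [RHS]addrC; apply: hwlog; rewrite addrC.
apply/esym/eqP; rewrite ab -trop_leEadd !expr2.
have le_ab : (a <= b)%O by rewrite trop_leEadd ab.
apply: le_trans (trop_ler_wM2r _ _ _ le_ab) _.
by rewrite mulrC; exact: trop_ler_wM2r.
Qed.

Lemma trop_mulV a : a != 0 -> a * tinv a = 1.
Proof.
case: a => [[r| |] p] //.
have -> : MkRmax p = tfin r by exact: val_inj.
by move=> _; rewrite tinvE tmulE subrr.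
Qed.

(** A finite maximum is one of its terms; the sum being nonzero excludes the empty family. *)
Lemma trop_sum_sel (I : eqType) (s : seq I) (F : I -> Rmax R) :
  \sum_(i <- s) F i != 0 -> exists2 i, i \in s & \sum_(j <- s) F j = F i.
Proof.
elim: s => [|i s IHs]; first by rewrite big_nil eqxx.
rewrite big_cons; have [-> _|->] := trop_add_sel (F i) (\sum_(j <- s) F j).
  by exists i; rewrite ?mem_head.
by case/IHs => j js ->; exists j; rewrite // inE js orbT.
Qed.

Lemma trop_sum_ge {I : eqType} {s : seq I} (F : I -> Rmax R) {i} :
  i \in s -> (F i <= \sum_(j <- s) F j)%O.
Proof. by move=> si; rewrite (big_rem i) //=; exact: trop_le_addr. Qed.

End MaxPlus.

Section MaxPlusVectors.
Context {R : realType} {n : nat}.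
Implicit Types (A : 'M[Rmax R]_n) (u v : 'cV[Rmax R]_n).

Lemma tnorm_eq0 v : tnorm v = 0 -> v = 0.
Proof.
move=> v0; apply/colP => i; rewrite mxE.
have := trop_sum_ge (fun j => v j ord0) (mem_index_enum i).
by rewrite -/(tnorm v) v0 trop_leEadd addr0 => /eqP.
Qed.

Lemma tnorm_sum (s : seq 'cV[Rmax R]_n) alpha :
  tnorm (\sum_(y <- s) alpha y *: y) = \sum_(y <- s) alpha y * tnorm y.
Proof.
rewrite /tnorm; under [RHS]eq_bigr do rewrite mulr_sumr.
rewrite exchange_big; apply: eq_bigr => i _.
by rewrite summxE; apply: eq_bigr => y _; rewrite mxE.
Qed.

(** Squaring is additive here, so it passes through the sum defining the norm. *)
Lemma trop_dot_self v : (v^T *m v) ord0 ord0 = tnorm v ^+ 2.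
Proof.
rewrite /tnorm mxE; under eq_bigr do rewrite mxE -expr2.
apply/esym/(big_morph (fun a : Rmax R => a ^+ 2)); first exact: trop_sqrD.
by rewrite expr0n.
Qed.

(** Expanding the form at [u + v] gives the form at [u] plus further terms, which can only raise the
    maximum. *)
Lemma trop_form_le_addr A u v :
  ((u^T *m A *m u) ord0 ord0 <= ((u + v)^T *m A *m (u + v)) ord0 ord0)%O.
Proof.
rewrite [(_ + _)^T]raddfD /= !mulmxDl mulmxDr -addrA [X in (_ <= X)%O]mxE.
exact: trop_le_addr.
Qed.

Lemma trop_formZ A a v :
  ((a *: v)^T *m A *m (a *: v)) ord0 ord0
  = a ^+ 2 * (v^T *m A *m v) ord0 ord0.
Proof.
by rewrite [(_ *: _)^T]linearZ /= -!scalemxAl -scalemxAr !mxE mulrA.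
Qed.

Lemma gen_eigenvector_form {A lam v} :
  scaled v -> gen_eigenvector A lam v -> (v^T *m A *m v) ord0 ord0 = lam.
Proof.
move=> [_ v1] [_ ->].
by rewrite mxE trop_dot_self v1 -toneE expr1n mulr1.
Qed.

Lemma rayleigh_scaled {A v} :
  scaled v -> rayleigh A v = (v^T *m A *m v) ord0 ord0.
Proof.
move=> [_ v1]; rewrite /rayleigh trop_dot_self v1 -toneE expr1n.
by rewrite -[tinv 1]mul1r trop_mulV ?mulr1 // oner_neq0.
Qed.

End MaxPlusVectors.

Theorem theorem6p4 (R : realType) (n : nat) (A : 'M[Rmax R]_n)
    (lam : 'I_n -> Rmax R)
    (lam_eigen : trop_eigenvalues A lam)
    (lam_sorted : forall i j : 'I_n, (i <= j)%N -> (lam i <= lam j)%O)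
    (k : 'I_n) (x : 'I_n -> 'cV[Rmax R]_n)
    (x_scaled : forall i, scaled (x i))
    (x_eigen : forall i, gen_eigenvector A (lam i) (x i)) :
  let S := tspan [set x i | i in [set i : 'I_n | (k <= i)%N]] in
  is_minimum [set rayleigh A u | u in [set u | S u /\ u != 0]] (lam k).
Proof.
move=> S; split.
  exists (x k).
    split; last by case: (x_scaled k).
    exists [:: x k], (fun=> 1); split=> //; last by rewrite big_seq1 scale1r.
    by move=> y; rewrite inE => /eqP ->; exists k => /=.
  by rewrite rayleigh_scaled // (gen_eigenvector_form _ (x_eigen k)).
move=> _ [u [[s [alpha [_ sV u_def]]] u0] <-].
have nu : tnorm u = \sum_(y <- s) alpha y.
  rewrite u_def tnorm_sum big_seq [RHS]big_seq; apply: eq_bigr => y /sV [i _ <-].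
  by case: (x_scaled i) => _ ->; rewrite -toneE mulr1.
have nu0 : tnorm u != 0 by apply: contra_neq u0 => /tnorm_eq0.
have [y ys ny] : exists2 y, y \in s & tnorm u = alpha y.
  by rewrite nu; apply: trop_sum_sel; rewrite -nu.
have [i ki xiy] := sV y ys.
apply: le_trans (lam_sorted _ _ ki) _.
rewrite -(gen_eigenvector_form (x_scaled i) (x_eigen i)) xiy /rayleigh.
(* The Rayleigh quotient is a true quotient only when its denominator is not epsilon, where [tinv]
   takes a dummy value. The norm is invertible, so its square cannot vanish. *)
have nu2 : (u^T *m u) ord0 ord0 != 0.
  rewrite trop_dot_self; apply: contra_neq (nu0) => nu2.
  by rewrite -[LHS]mulr1 -(trop_mulV _ nu0) mulrA -expr2 nu2 mul0r.
(* Writing 1 as the denominator times its inverse on the left leaves only the numerators to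
   compare. *)
rewrite -[X in (X <= _)%O]mulr1 -(trop_mulV _ nu2) mulrA.
apply: trop_ler_wM2r.
(* The denominator is [alpha y ^+ 2], which turns the left side into the form at [alpha y *: y], a
   single summand of [u]. *)
rewrite trop_dot_self ny mulrC -trop_formZ u_def (big_rem y) //=.
exact: trop_form_le_addr.
Qed.
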